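(* A tree $T$ is $(\iota,1)$-critical if and only if $T\in\mathcal{F}_\iota$.
   Context: For $D\subseteq V(T)$, $N[D]$ is $D$ with all neighbours; $D$ is isolating if $T-N[D]$ has no edges; $\iota(T)$ is the minimum size of an isolating set. $T_e$ is obtained by subdividing edge $e$ once. $T$ is $(\iota,1)$-critical if $\iota(T_e)>\iota(T)$ for every edge $e$ (and $T$ has an edge). The family $\mathcal{F}_\iota$ consists of trees $T$ for which there is a sequence $T_1,\dots,T_j$ ($j\ge1$) with $T_1=P_5$, $T_j=T$, each $T_{i+1}$ obtained from $T_i$ by one of the operations below, where each vertex carries a status $A$, $B$ or $C$ that, once assigned, never changes. In $T_1=P_5$ the middle vertex has status $A$, the two support vertices have status $B$, the two leaves have status $C$. Operation $\mathcal{O}_1$: add a new vertex $x$ and an edge $xy$ where $y$ has status $B$; the new vertex $x$ gets status $C$. Operation $\mathcal{O}_2$: add a path $u v$ and an edge $xu$ where $x$ has status $A$; $u$ gets status $B$ and $v$ gets status $C$. Operation $\mathcal{O}_3$: add a path $u v w z$ and an edge $xu$ where $x$ has status $C$; $u,v,w,z$ get statuses $B,A,B,C$ respectively. *)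

(* Defs.v *)
From mathcomp Require Import all_boot.

Set Implicit Arguments.
Unset Strict Implicit.
Unset Printing Implicit Defensive.

Record sgraph := SGraph {
  vertex :> finType;
  adj : rel vertex;
  adj_sym : symmetric adj;
  adj_irr : irreflexive adj }.

Arguments adj {s}.

Definition isomorphic (G H : sgraph) : Prop :=
  exists2 f : G -> H, bijective f & forall x y, adj (f x) (f y) = adj x y.

(* [ucycle] also accepts the degenerate cycles [::] and, for an edge xy,
   [:: x; y]; genuine cycles are those with at least three vertices. *)
Definition is_tree (G : sgraph) : Prop :=
  [/\ 0 < #|G|,
      forall x y : G, connect adj x y
    & forall c : seq G, ucycle adj c -> size c <= 2].

Section Isolation.
Variable G : sgraph.

Definition closed_nbhd (D : {set G}) : {set G} :=
  [set x | [exists d in D, (x == d) || adj d x]].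

Definition isolating (D : {set G}) : bool :=
  [forall x in ~: closed_nbhd D, forall y in ~: closed_nbhd D, ~~ adj x y].

Lemma isolating_setT : isolating setT.
Proof.
apply/forall_inP => x; rewrite inE => /negP[]; rewrite inE.
by apply/existsP; exists x; rewrite inE eqxx.
Qed.

Definition isolation_number : nat :=
  #|[arg min_(D < [set: G] | isolating D) #|D| ]|.

End Isolation.

(* Meant for an edge ab; [None] is the subdividing vertex. *)
Section Subdivision.
Variables (G : sgraph) (a b : G).

Definition subdiv_adj : rel (option G) := fun u v =>
  match u, v with
  | Some x, Some y => adj x y && ([set x; y] != [set a; b])
  | Some x, None | None, Some x => x \in [set a; b]
  | None, None => false
  end.

Lemma subdiv_sym : symmetric subdiv_adj.
Proof. by case=> [x|] [y|] //=; rewrite adj_sym setUC. Qed.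

Lemma subdiv_irr : irreflexive subdiv_adj.
Proof. by case=> [x|] //=; rewrite adj_irr. Qed.

Definition subdivide : sgraph := SGraph subdiv_sym subdiv_irr.

End Subdivision.

Definition iota1_critical (G : sgraph) : Prop :=
  (exists x y : G, adj x y) /\
  forall x y : G, adj x y ->
    isolation_number G < isolation_number (subdivide x y).

Section PathGraph.
Variable n : nat.

Definition path_adj : rel 'I_n := fun i j => (i.+1 == j) || (j.+1 == i).

Lemma path_sym : symmetric path_adj.
Proof. by move=> i j; rewrite /path_adj orbC. Qed.

Lemma path_irr : irreflexive path_adj.
Proof. by move=> i; rewrite /path_adj -[X in _ == X]addn0 -addn1 eqn_add2l. Qed.

Definition path_graph : sgraph := SGraph path_sym path_irr.

End PathGraph.

(* Disjoint union of G and H together with the single edge xy. *)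
Section Attach.
Variables (G H : sgraph) (x : G) (y : H).

Definition attach_adj : rel (G + H)%type := fun u v =>
  match u, v with
  | inl a, inl b => adj a b
  | inr a, inr b => adj a b
  | inl a, inr b | inr b, inl a => (a == x) && (b == y)
  end.

Lemma attach_sym : symmetric attach_adj.
Proof. by case=> a [] b //=; rewrite adj_sym. Qed.

Lemma attach_irr : irreflexive attach_adj.
Proof. by case=> a /=; rewrite adj_irr. Qed.

Definition attach : sgraph := SGraph attach_sym attach_irr.

End Attach.

Inductive status := StA | StB | StC.

Record stgraph := StGraph {
  graph_of :> sgraph;
  st : graph_of -> status }.

Definition stpath n (s : n.-tuple status) : stgraph :=
  @StGraph (path_graph n) (tnth s).

Definition start_P5 : stgraph := stpath [tuple StC; StB; StA; StB; StC].

(* Attaches the path carrying statuses [s] by an edge from [x] to its first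
   vertex; the old vertices keep their status. *)
Definition attach_stpath (G : stgraph) (x : G) n (s : n.+1.-tuple status)
    : stgraph :=
  @StGraph (@attach G (stpath s) x ord0)
    (fun u => match u with inl v => st v | inr i => tnth s i end).

Definition op1 (G : stgraph) (y : G) : stgraph :=
  attach_stpath y [tuple StC].
Definition op2 (G : stgraph) (x : G) : stgraph :=
  attach_stpath x [tuple StB; StC].
Definition op3 (G : stgraph) (x : G) : stgraph :=
  attach_stpath x [tuple StB; StA; StB; StC].

Inductive constructible : stgraph -> Prop :=
| constructible_start : constructible start_P5
| constructible_op1 (G : stgraph) (y : G) :
    constructible G -> st y = StB -> constructible (op1 y)
| constructible_op2 (G : stgraph) (x : G) :
    constructible G -> st x = StA -> constructible (op2 x)
| constructible_op3 (G : stgraph) (x : G) :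
    constructible G -> st x = StC -> constructible (op3 x).

Definition in_family (T : sgraph) : Prop :=
  exists2 G : stgraph, constructible G & isomorphic T G.

(* Main.v *)
Require Import Defs.
From mathcomp Require Import all_boot.

(** A tree lies in the family iff its vertices can be labelled so that all
    neighbours of an A-vertex are B and it has at least two, a B-vertex has
    exactly one A-neighbour and its other neighbours, at least one, are C, and
    all neighbours of a C-vertex are B.

    A critical tree has such a labelling: take a minimum isolating set as A, its
    neighbours as B and the rest as C; any defect lets some subdivision keep a
    minimum isolating set.  A labelled tree, rooted at an A-vertex, is rebuilt
    downwards from a P5 around the root: a topmost missing vertex, with a few of
    its descendants, is added by the operation its parent's status allows.

    Conversely, given an edge e of a labelled tree, root the tree at the A-vertex
    [r] next to the B-end of e, and let the unit of an A-vertex consist of it, its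
    neighbours and their C-children; the subdividing vertex joins the unit of
    [r].  An isolating set of the subdivision meets every unit, so if it has no
    more elements than there are A-vertices it meets each unit once.  A descent
    shows that it then contains no B-vertex through which the tree enters a unit
    from above, so the units do not help each other, and the unit of [r], which
    now contains two edges far apart, needs two elements. *)

Set Implicit Arguments.
Unset Strict Implicit.
Unset Printing Implicit Defensive.

(** * Rooted trees *)

Section Rooted.
Variable G : sgraph.

(** [d] need not be the distance to the root: any function that drops along [par] serves as a
    measure for descents. The test [u != v] keeps [par r = r] from producing a loop at [r]. *)
Definition rooted (r : G) (par : G -> G) (d : G -> nat) : Prop :=
  [/\ par r = r, forall v, v != r -> d (par v) < d v
    & forall u v, adj u v = (u != v) && ((par u == v) || (par v == u))].

Lemma adj_neq (u v : G) : adj u v -> u != v.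
Proof. by apply: contraTneq => ->; rewrite adj_irr. Qed.

(** A duplicate-free walk from [p] to a different [q] that avoids [v] closes up through [v] to a
    cycle with at least three vertices. *)
Lemma tree_nbr_separated (hG : is_tree G) (v p q : G) :
    adj v p -> adj v q ->
    connect [rel x y | [&& adj x y, x != v & y != v]] p q -> p = q.
Proof.
case: hG => _ _ acyc vp vq /connectP[t0 pt0 lt0].
case/shortenP: pt0 lt0 => t pt ut _ lt.
case: t pt ut lt => [|w t] pt ut lt //.
suff /acyc : ucycle adj [:: v, p, w & t] by [].
apply/andP; split.
  rewrite (cycle_path v) [last _ _]/= [last _ _](esym lt).
  rewrite -[path _ _ _]/[&& adj q v, adj v p & path adj p (w :: t)].
  rewrite adj_sym vq vp; apply: sub_path pt => x y /andP[] //.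
rewrite cons_uniq ut andbT in_cons negb_or adj_neq //=.
have : all (fun y => y != v) (w :: t).
  elim: (w :: t) p pt {ut lt vp} => //= y t' IH x /andP[/and3P[_ _ ->] /IH //].
by move=> /allP h; apply/negP => /h; rewrite eqxx.
Qed.

(** [d v] is the least length of a walk from [r] to [v], and [p] is the last vertex but one of such
    a walk. *)
Lemma connected_depth (hG : forall x y : G, connect adj x y) (r : G) :
  exists2 d : G -> nat, d r = 0
    & forall v, v != r -> exists2 p, adj v p & d p < d v.
Proof.
pose P v n := [exists t : n.-tuple G, path adj r t && (last r t == v)].
have exP v : exists n, P v n.
  have /connectP[t pt lt] := hG r v.
  by exists (size t); apply/existsP; exists (in_tuple t); rewrite /= pt lt eqxx.
exists (fun v => ex_minn (exP v)) => [|v vr].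
  case: ex_minnP => m _ /(_ 0); rewrite leqn0 => h; apply/eqP/h.
  by apply/existsP; exists [tuple]; rewrite /= eqxx.
case: (ex_minnP (exP v)) => n /existsP[[t /= /eqP st]].
case/lastP: t st => [|t p] st /andP[pt /eqP lt] _.
  by rewrite -lt eqxx in vr.
rewrite last_rcons in lt; rewrite lt rcons_path in pt; case/andP: pt => pt lv.
exists (last r t); first by rewrite adj_sym.
case: ex_minnP => m _ /(_ (size t)); rewrite -st size_rcons ltnS; apply.
by apply/existsP; exists (in_tuple t); rewrite /= pt eqxx.
Qed.

(** Two neighbours of [v] of depth at most [d v] coincide, because walks of falling depth lead from
    both to [r] without meeting [v]. So no edge joins vertices of equal depth, and the parent is the
    unique neighbour nearer the root. *)
Lemma tree_rooted (hG : is_tree G) (r : G) : exists par d, rooted r par d.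
Proof.
have [_ conG _] := hG; have [d d0 dP] := connected_depth conG r.
pose e v := [rel x y : G | [&& adj x y, x != v & y != v]].
have to_root p v : p != v -> d p <= d v -> connect (e v) p r.
  have [n] := ubnP (d p); elim: n p => // n IH p dn pv dpv.
  have [->|pr] := eqVneq p r; first exact: connect0.
  have [q pq dqp] := dP _ pr.
  have dqv := leq_trans dqp dpv.
  have qv : q != v by apply: contraTneq dqv => ->; rewrite ltnn.
  apply: connect_trans (IH q _ qv (ltnW dqv)); last exact: leq_trans dqp _.
  by apply: connect1; rewrite /= pq pv.
have uniqp v p q : adj v p -> adj v q -> d p <= d v -> d q <= d v -> p = q.
  move=> vp vq dp dq; apply: (tree_nbr_separated hG vp vq).
  have e_sym : connect_sym (e v).
    by apply: sym_connect_sym => x y; rewrite /= adj_sym [_ && (y != v)]andbC.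
  have vnbr w : adj v w -> w != v by rewrite eq_sym; apply: adj_neq.
  apply: connect_trans (to_root _ _ (vnbr _ vp) dp) _.
  by rewrite e_sym; apply: to_root (vnbr _ vq) dq.
pose par v := odflt r [pick p | adj v p && (d p < d v)].
have parP v : v != r -> adj v (par v) && (d (par v) < d v).
  move=> /dP[p vp dp]; rewrite /par; case: pickP => [//|/(_ p)].
  by rewrite vp dp.
have parr : par r = r by rewrite /par; case: pickP => // p; rewrite d0 andbF.
have par_lower u v : adj u v -> d u <= d v -> par v = u.
  move=> uv duv; have vr : v != r.
    apply/eqP => vr; move: uv duv; rewrite vr d0 leqn0 => ur /eqP du.
    by have [p _] := dP u (adj_neq ur); rewrite du.
  have /andP[vp dp] := parP _ vr.
  by apply: (uniqp v) vp _ (ltnW dp) duv; rewrite adj_sym.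
exists par, d; split=> // [v /parP/andP[] //|u v].
apply/idP/idP => [uv|/andP[uv]].
  apply/andP; split; first exact: adj_neq.
  have [duv|dvu] := leqP (d u) (d v); first by rewrite (par_lower u v) ?eqxx ?orbT.
  by rewrite (par_lower v u) ?eqxx ?(ltnW dvu) // adj_sym.
have padj x : x != par x -> adj x (par x).
  move=> xp; have /parP/andP[] // : x != r.
  by apply: contraNneq xp => ->; rewrite parr.
case/orP=> /eqP h; first by rewrite -h padj // h.
by rewrite adj_sym -h padj // h eq_sym.
Qed.

Lemma rooted_lt r par d (hr : rooted r par d) (u v : G) :
  u != v -> par v = u -> d u < d v.
Proof.
case: hr => pr dlt _ uv pv; rewrite -pv; apply: dlt.
by apply: contraNneq uv => vr; rewrite -pv vr pr.
Qed.

Lemma rooted_adj r par d (hr : rooted r par d) (u v : G) :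
  adj u v -> (par u = v /\ d v < d u) \/ (par v = u /\ d u < d v).
Proof.
case: (hr) => _ _ -> /andP[uv /orP[]/eqP h]; [left|right]; split=> //.
  by apply: (rooted_lt hr _ h); rewrite eq_sym.
exact: (rooted_lt hr uv h).
Qed.

End Rooted.

(** * Labellings *)

(* In the first case, "for every [w] a neighbour other than [w]" says that there
   are at least two neighbours. *)
Definition ok_at (G : sgraph) (s : G -> status) (v : G) : Prop :=
  match s v with
  | StA => (forall y, adj v y -> s y = StB)
           /\ (forall w, exists2 b, adj v b & b != w)
  | StB => (exists a, [/\ adj v a, s a = StA
                        & forall y, adj v y -> y = a \/ s y = StC])
           /\ (exists2 c, adj v c & s c = StC)
  | StC => forall y, adj v y -> s y = StB
  end.

Definition labelled (G : sgraph) (s : G -> status) : Prop :=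
  (exists a, s a = StA) /\ forall v, ok_at s v.

Section LabelledFacts.
Variables (G : sgraph) (s : G -> status).
Hypothesis hs : forall v, ok_at s v.

Lemma nbrA a y : s a = StA -> adj a y -> s y = StB.
Proof. by move=> sa; have := hs a; rewrite /ok_at sa => -[h _]; apply: h. Qed.

Lemma nbrC c y : s c = StC -> adj c y -> s y = StB.
Proof. by move=> sc; have := hs c; rewrite /ok_at sc; apply. Qed.

Lemma nbrA2 a w : s a = StA -> exists2 b, adj a b & b != w.
Proof. by move=> sa; have := hs a; rewrite /ok_at sa => -[_ h]; apply: h. Qed.

Lemma nbrB b : s b = StB -> exists a, [/\ adj b a, s a = StA
   & forall y, adj b y -> y = a \/ s y = StC].
Proof. by move=> sb; have := hs b; rewrite /ok_at sb => -[]. Qed.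

Lemma nbrBC b : s b = StB -> exists2 c, adj b c & s c = StC.
Proof. by move=> sb; have := hs b; rewrite /ok_at sb => -[]. Qed.

Lemma nbrBA b a a' : s b = StB -> adj b a -> s a = StA -> adj b a' ->
  a' = a \/ s a' = StC.
Proof.
move=> sb ba sa; have [a0 [_ _ h]] := nbrB sb.
by case: (h _ ba) => [->|]; [apply: h|rewrite sa].
Qed.

End LabelledFacts.

(** Among the old vertices only [x] gains a neighbour, and the status prescribed for it is the one
    that the condition at [x] tolerates. Only the new vertices remain to be checked. *)
Lemma attach_labelled (G : stgraph) (x : G) n (t : n.+1.-tuple status) :
    labelled (@st G) ->
    tnth t ord0 = match st x with StA => StB | StB => StC | StC => StB end ->
    (forall i, ok_at (@st (attach_stpath x t)) (inr i)) ->
  labelled (@st (attach_stpath x t)).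
Proof.
case=> -[a sa] hG ht hi; split; first by exists (inl a).
case=> [v|i] //; have := hG v; rewrite /ok_at /=.
case sv: (st v) => /=.
- case=> hB h2; split.
    case=> [y|i] /=; first exact: hB.
    by case/andP=> /eqP vx /eqP->; rewrite ht -vx sv.
  (* If [w] is a new vertex, every old neighbour differs from it, so [v] is a mere default. *)
  move=> w; pose v0 := if w is inl v0 then v0 else v.
  have [b vb bv] := h2 v0; exists (inl b) => //.
  by rewrite /v0 in bv; case: (w) bv.
- case=> -[a' [va sa' h1]] [c vc sc]; split; last by exists (inl c).
  exists (inl a'); split=> // -[y|i] /=.
    by case/h1=> [->|]; [left|right].
  by case/andP=> /eqP vx /eqP->; right; rewrite ht -vx sv.
- move=> h [y|i] /=; first exact: h.
  by case/andP=> /eqP vx /eqP->; rewrite ht -vx sv.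
Qed.

Ltac ord_cases := case=> [[|[|[|[|[|//]]]]] ?] //.

Lemma P5_labelled : labelled (@st start_P5).
Proof.
pose o k (h : k < 5) : start_P5 := Ordinal h.
split; first by exists (o 2 isT).
have two (a b1 b2 : start_P5) : adj a b1 -> adj a b2 -> b1 != b2 ->
    forall w, exists2 b, adj a b & b != w.
  move=> h1 h2 h12 w; have [e|ne] := eqVneq b1 w; last by exists b1.
  by exists b2 => //; rewrite -e eq_sym.
ord_cases; rewrite /ok_at /=.
- by ord_cases.
- split; last by exists (o 0 isT).
  exists (o 2 isT); split=> //; ord_cases => _; [by right|by left; apply: val_inj].
- by split; [ord_cases|apply: (two _ (o 1 isT) (o 3 isT))].
- split; last by exists (o 4 isT).
  exists (o 2 isT); split=> //; ord_cases => _; [by left; apply: val_inj|by right].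
- by ord_cases.
Qed.

Lemma constructible_labelled (G : stgraph) : constructible G -> labelled (@st G).
Proof.
elim=> {G} [|G y _ hG sy|G x _ hG sx|G x _ hG sx]; first exact: P5_labelled.
- apply: attach_labelled => //; first by rewrite sy.
  case=> [[|//] ?]; rewrite /ok_at /=.
  by case=> [z|[[|//] ?]] //= /andP[/eqP-> _].
- apply: attach_labelled => //; first by rewrite sx.
  case=> [[|[|//]] ?]; rewrite /ok_at /=.
    split; last by exists (inr (Ordinal (isT : 1 < 2))).
    exists (inl x); split=> //=; first by rewrite !eqxx.
    by case=> [z /= /andP[/eqP->]|[[|[|//]] ?]] //; [left|right].
  by case=> [z /andP[]|[[|[|//]] ?]].
- apply: attach_labelled => //; first by rewrite sx.
  pose o k (h : k < 4) : path_graph 4 := Ordinal h.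
  case=> [[|[|[|[|//]]]] ?]; rewrite /ok_at /=.
  + split; last by exists (inl x); rewrite //= !eqxx.
    exists (inr (o 1 isT)); split=> //.
    case=> [z /= /andP[/eqP->]|]; first by right.
    by ord_cases => _; left; congr inr; apply: val_inj.
  + split; first by case=> [z /andP[]|] //; ord_cases.
    move=> w; have [->|ne] := eqVneq w (inr (o 0 isT)).
      by exists (inr (o 2 isT)).
    by exists (inr (o 0 isT)) => //; rewrite eq_sym.
  + split; last by exists (inr (o 3 isT)).
    exists (inr (o 1 isT)); split=> //.
    case=> [z /andP[]|] //.
    ord_cases => _; last by right.
    by left; congr inr; apply: val_inj.
  + by case=> [z /andP[]|] //; ord_cases.
Qed.

(** * Critical trees have a labelling *)

Section Isolating.
Variable G : sgraph.
Implicit Types (D : {set G}) (u v x y : G).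

Lemma closed_nbhdP D x :
  reflect (exists2 d, d \in D & d = x \/ adj d x) (x \in closed_nbhd D).
Proof.
rewrite inE; apply: (iffP exists_inP) => -[d dD].
  by case/orP=> [/eqP->|dx]; exists d; auto.
by case=> [<-|dx]; exists d => //; rewrite ?eqxx ?dx ?orbT.
Qed.

Lemma isolatingP D :
  reflect (forall u v, adj u v -> u \in closed_nbhd D \/ v \in closed_nbhd D)
          (isolating D).
Proof.
apply: (iffP forall_inP) => h.
  move=> u v uv; case: (boolP (u \in closed_nbhd D)) => uN; first by left.
  right; apply: contraLR uv => vN.
  by have /forall_inP := h u (etrans (in_setC _ _) uN); apply; rewrite in_setC.
move=> u; rewrite in_setC => uN; apply/forall_inP => v; rewrite in_setC => vN.
by apply/negP => /h[]; [rewrite (negPf uN)|rewrite (negPf vN)].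
Qed.

Lemma isolation_number_le D : isolating D -> isolation_number G <= #|D|.
Proof.
rewrite /isolation_number; case: arg_minnP => [|D0 _ h]; first exact: isolating_setT.
exact: h.
Qed.

Lemma isolation_number_ex :
  exists2 D : {set G}, isolating D & #|D| = isolation_number G.
Proof.
rewrite /isolation_number; case: arg_minnP => [|D0 iD _]; first exact: isolating_setT.
by exists D0.
Qed.

End Isolating.

(** * Edges of a critical graph *)

Section CriticalLabel.
Variable G : sgraph.
Hypothesis crit : iota1_critical G.

(** When the edge [xy] is subdivided, [x] is no longer dominated and the edge [xc] becomes
    uncovered. *)
Definition uncovers (D : {set G}) (x y : G) : Prop :=
  [/\ y \in D, x \notin D, (forall d, d \in D -> adj d x -> d = y)
    & exists2 c, adj x c & c \notin closed_nbhd D].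

(* A minimum isolating set of [G] is too small to isolate the subdivision of
   [ab]: either the new vertex ends an uncovered edge, or one end of [ab] was
   dominated only across [ab]. *)
Lemma crit_edge (D : {set G}) (a b : G) :
    isolating D -> #|D| <= isolation_number G -> adj a b ->
  [\/ [/\ a \notin D, b \notin D & (a \notin closed_nbhd D) || (b \notin closed_nbhd D)],
      uncovers D a b | uncovers D b a].
Proof.
move=> /isolatingP iD cD ab; have [_ /(_ _ _ ab) lt] := crit.
pose D' : {set subdivide a b} := [set Some x | x in D].
have D'P x : Some x \in D' = (x \in D) by apply: mem_imset => ? ? [].
have : ~~ isolating D'.
  apply: contraL lt => /isolation_number_le; rewrite -leqNgt => /leq_trans; apply.
  exact: leq_trans (leq_imset_card _ _) cD.
have abD c : (c == a) || (c == b) -> c \in D -> None \in closed_nbhd D'.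
  move=> e cD'; apply/closed_nbhdP; exists (Some c); rewrite ?D'P //.
  by right; rewrite /= !inE.
have dom v : Some v \notin closed_nbhd D' -> v \in closed_nbhd D ->
    v \notin D /\ forall d, d \in D -> adj d v -> [set d; v] = [set a; b].
  move=> vN _; split.
    by apply: contra vN => vD; apply/closed_nbhdP; exists (Some v); rewrite ?D'P; auto.
  move=> d dD dv; apply/eqP; apply: contraNT vN => ne.
  by apply/closed_nbhdP; exists (Some d); rewrite ?D'P //=; right; rewrite dv.
have edge_ends d v : adj d v -> [set d; v] = [set a; b] ->
    (d = a /\ v = b) \/ (d = b /\ v = a).
  move=> dv e; have := set21 d v; have := set22 d v; rewrite e !inE.
  move=> /orP[]/eqP vE /orP[]/eqP dE; auto.
    by move: dv; rewrite vE dE adj_irr.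
  by move: dv; rewrite vE dE adj_irr.
have N' w : w \in closed_nbhd D -> w != a -> w != b -> Some w \in closed_nbhd D'.
  move=> wN wa wb; apply/negPn/negP => /dom/(_ wN)[wD h].
  have /closed_nbhdP[d dD [dw|dw]] := wN; first by rewrite -dw dD in wD.
  by have [[_ e]|[_ e]] := edge_ends _ _ dw (h _ dD dw); rewrite e eqxx in wa wb.
(* An uncovered edge between old vertices: its end [u] dominated in [G] is an end of [ab], dominated
   only by the other end, and [v] is the undominated witness. *)
have key u v : adj u v -> [set u; v] != [set a; b] ->
    Some u \notin closed_nbhd D' -> Some v \notin closed_nbhd D' ->
    u \in closed_nbhd D -> uncovers D a b \/ uncovers D b a.
  move=> uv ne uN vN /[dup] uD /closed_nbhdP[d dD].
  have [uD' hd] := dom _ uN uD.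
  case=> [du|du]; first by rewrite -du dD in uD'.
  have vc : (v != a) && (v != b).
    apply/andP; split; apply: contraTneq uv => e; apply/negP => uv.
      have [[]|[]] := edge_ends _ _ du (hd _ dD du) => e1 e2.
        by rewrite e e2 setUC eqxx in ne.
      by rewrite e e2 adj_irr in uv.
    have [[]|[]] := edge_ends _ _ du (hd _ dD du) => e1 e2.
      by rewrite e e2 adj_irr in uv.
    by rewrite e e2 eqxx in ne.
  have vD : v \notin closed_nbhd D.
    by apply: contra vN => vN; case/andP: vc; apply: N'.
  have [[d1 u1]|[d1 u1]] := edge_ends _ _ du (hd _ dD du); [right|left]; split=> //.
  - by rewrite -d1.
  - by rewrite -u1.
  - move=> d' d'D d'b; rewrite -u1 in d'b.
    have [[-> //]|[_ e]] := edge_ends _ _ d'b (hd _ d'D d'b).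
    by rewrite -e u1 adj_irr in ab.
  - by exists v; rewrite // -u1.
  - by rewrite -d1.
  - by rewrite -u1.
  - move=> d' d'D d'b; rewrite -u1 in d'b.
    have [[_ e]|[-> //]] := edge_ends _ _ d'b (hd _ d'D d'b).
    by rewrite -e u1 adj_irr in ab.
  - by exists v; rewrite // -u1.
(* An uncovered edge at the new vertex: [a] and [b] lie outside [D], so a dominator of [u] in [G]
   would reach it by an edge other than [ab]. *)
have keyN u : u \in [set a; b] -> None \notin closed_nbhd D' ->
    Some u \notin closed_nbhd D' ->
    [/\ a \notin D, b \notin D
      & (a \notin closed_nbhd D) || (b \notin closed_nbhd D)].
  move=> uab NN uN.
  have aD : a \notin D by apply: contra NN; apply: abD; rewrite eqxx.
  have bD : b \notin D by apply: contra NN; apply: abD; rewrite eqxx orbT.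
  split=> //; rewrite -negb_and; apply: contra uN => /andP[aN bN].
  have : u \in closed_nbhd D by case/set2P: uab => ->.
  move=> /closed_nbhdP[d dD [<-|du]]; apply/closed_nbhdP.
    by exists (Some d); rewrite ?D'P; auto.
  exists (Some d); rewrite ?D'P //=; right; rewrite du /=.
  apply: contraNneq aD => e.
  have : d \in [set a; b] by rewrite -e set21.
  by case/set2P => dE; rewrite dE in dD => //; rewrite dD in bD.
case/forall_inPn=> p; rewrite in_setC => pN /forall_inPn[q].
rewrite in_setC => qN; rewrite negbK.
case: p q pN qN => [u|] [v|] //= pN qN.
- case/andP=> uv ne; have [uD|vD] := iD _ _ uv.
    by have [] := key u v uv ne pN qN uD; [apply: Or32|apply: Or33].
  rewrite adj_sym in uv; rewrite setUC in ne.
  by have [] := key v u uv ne qN pN vD; [apply: Or32|apply: Or33].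
- by move=> h; apply: Or31; apply: keyN h qN pN.
- by move=> h; apply: Or31; apply: keyN h pN qN.
Qed.

(** If [v] were the only neighbour of [a], exchanging [a] for [v] in [D] would keep it isolating and
    no larger, and the edge [av] would then fit no case of [crit_edge]. *)
Lemma crit_not_leaf (D : {set G}) (a v : G) :
    isolating D -> #|D| <= isolation_number G -> a \in D -> adj a v ->
  exists2 b, adj a b & b != v.
Proof.
move=> /isolatingP iD cD aD av.
have [/exists_inP[b ab bv]|] := boolP [exists b in adj a, b != v].
  by exists b.
move=> nb0; have nb := exists_inPn nb0; exfalso.
have nbv b : adj a b -> b = v by move=> /nb; rewrite negbK => /eqP.
pose D' := v |: D :\ a.
have ND x : x \in closed_nbhd D -> x \in closed_nbhd D'.
  case/closed_nbhdP=> d dD h; apply/closed_nbhdP.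
  have [da|da] := eqVneq d a; last by exists d; rewrite // in_setU in_setD1 da dD orbT.
  exists v; first by rewrite !inE eqxx.
  by move: h; rewrite da => -[<-|/nbv ->]; [right; rewrite adj_sym|left].
have iD' : isolating D' by apply/isolatingP => x y /iD[] /ND; auto.
have cD' : #|D'| <= isolation_number G.
  apply: leq_trans cD; rewrite (cardsD1 a D) aD.
  by apply: leq_trans (leq_card_setU _ _) _; rewrite cards1.
have vD : v \in D' by rewrite !inE eqxx.
case: (crit_edge iD' cD' av) => [[_]|[_ _ _ [c /nbv->]]|[]].
- by rewrite vD.
- by case/closed_nbhdP; exists v; auto.
- by rewrite !inE eqxx orbF => /eqP va; rewrite va adj_irr in av.
Qed.

Lemma critical_labelled (hG : is_tree G) : exists s : G -> status, labelled s.
Proof.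
have [D iD cD] := isolation_number_ex G.
have {}cD : #|D| <= isolation_number G by rewrite cD.
have iDP := isolatingP _ iD.
pose s v := if v \in D then StA else if v \in closed_nbhd D then StB else StC.
have DN v : v \in D -> v \in closed_nbhd D by move=> vD; apply/closed_nbhdP; exists v; auto.
have DDN a v : a \in D -> adj a v -> v \in closed_nbhd D.
  by move=> aD av; apply/closed_nbhdP; exists a; auto.
have sA v : s v = StA -> v \in D by rewrite /s; case: ifP => // _; case: ifP.
have [[x0 [y0 xy0]] _] := crit.
exists s; split.
  have : exists a, a \in D.
    by case: (iDP _ _ xy0) => /closed_nbhdP[a aD _]; exists a.
  by case=> a aD; exists a; rewrite /s aD.
move=> v; rewrite /ok_at; case sv: (s v).
- have vD := sA _ sv; split.
    move=> y vy; rewrite /s (DDN _ _ vD vy); case: ifP => // yD.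
    by case: (crit_edge iD cD vy); case; rewrite ?vD ?yD.
  move=> w; have [vw|vw] := boolP (adj v w).
    exact: (crit_not_leaf iD cD vD vw).
  suff [b vb] : exists b, adj v b by exists b => //; apply: contraNneq vw => <-.
  have [->|vx] := eqVneq v x0; first by exists y0.
  case: hG => _ /(_ v x0)/connectP[[|b t]] /= pt lt _; first by rewrite lt eqxx in vx.
  by exists b; case/andP: pt.
- have [vD vN] : v \notin D /\ v \in closed_nbhd D.
    by move: sv; rewrite /s; case: ifP => // _; case: ifP.
  have /closed_nbhdP[a aD [av|av]] := vN; first by rewrite -av aD in vD.
  have va : adj v a by rewrite adj_sym.
  (* Since [a] is in [D] and [v] is not, only [uncovers D v a] survives; it makes [a] the sole
     A-neighbour and provides a C-neighbour. *)
  case: (crit_edge iD cD va) => [[_]|[_ _ hu [c vc cN]]|[]]; rewrite ?aD ?(negPf vD) //.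
  split.
    exists a; split=> //; first by rewrite /s aD.
    move=> y vy; rewrite /s; case: ifP => yD.
      by left; apply: hu => //; rewrite adj_sym.
    case: ifP => yN; last by right.
    (* An edge with both ends dominated and outside [D] fits no case. *)
    case: (crit_edge iD cD vy) => [[_ _]|[]|[]]; rewrite ?yD ?(negPf vD) //.
    by rewrite vN yN.
  by exists c => //; rewrite /s (negPf cN) ifN //; apply: contra cN; apply: DN.
- have vN : v \notin closed_nbhd D.
    by move: sv; rewrite /s; case: ifP => // _; case: ifP.
  move=> y vy; have [vN'|yN] := iDP _ _ vy; first by rewrite vN' in vN.
  rewrite /s yN; case: ifP => // yD.
  by case/negP: vN; apply: DDN yD _; rewrite adj_sym.
Qed.

End CriticalLabel.

(** * Labelled trees are constructible *)

Section Embed.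
Variables (T : sgraph) (s : T -> status) (r : T) (par : T -> T) (d : T -> nat).
Hypotheses (hs : forall v, ok_at s v) (hr : rooted r par d).

(** The image is an induced subgraph containing the root and closed under parents, so a missing
    vertex of least depth hangs from the image. *)
Definition embeds (G : stgraph) (f : G -> T) : Prop :=
  [/\ injective f, forall x y, adj (f x) (f y) = adj x y,
      forall x, s (f x) = st x & r \in codom f
      /\ forall x, par (f x) \in codom f].

(** Closure under parents keeps the whole descending path outside the image once its head is, and
    leaves the edge into the head as its only link to the image. *)
Lemma embeds_attach (G : stgraph) (f : G -> T) (x : G) n
    (t : n.+1.-tuple T) (q : n.+1.-tuple status) :
    embeds f -> path [rel p v | adj p v && (par v == p)] (f x) t ->
    thead t \notin codom f -> (forall i, s (tnth t i) = tnth q i) ->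
  exists g : attach_stpath x q -> T, embeds g.
Proof.
case=> fI fadj fs [fr fpar] pt out ts.
pose y i := nth r (f x :: t) i.
have tE (i : 'I_n.+1) : tnth t i = y i.+1 by rewrite (tnth_nth r).
have ypar i : i <= n -> par (y i.+1) = y i /\ adj (y i) (y i.+1).
  move=> lein; have := pathP r pt i; rewrite size_tuple ltnS => /(_ lein).
  by case/andP=> h /eqP.
have dlt i : i <= n -> d (y i) < d (y i.+1).
  by move=> /ypar[yp ya]; apply: (rooted_lt hr (adj_neq ya) yp).
have dmono i j : i < j -> j <= n.+1 -> d (y i) < d (y j).
  elim: j => // j IH; rewrite !ltnS leq_eqVlt => /orP[/eqP->|ij] jn; first exact: dlt.
  exact: ltn_trans (IH ij (leqW jn)) (dlt _ jn).
have yI i j : i <= n.+1 -> j <= n.+1 -> y i = y j -> i = j.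
  by move=> iN jN e; case: (ltngtP i j) => // /dmono/(_ ltac:(assumption)); rewrite e ltnn.
have yout i : i <= n -> y i.+1 \notin codom f.
  elim: i => [_|i IH lein].
    by move: out; rewrite /thead tE.
  apply: contra (IH (ltnW lein)) => /codomP[z yz].
  by have [<- _] := ypar _ lein; rewrite yz.
have adjE : forall u v, adj u v = (u != v) && ((par u == v) || (par v == u)) by case: hr.
have fy z (i : 'I_n.+1) : adj (f z) (y i.+1) = (z == x) && (i == ord0).
  have ine : f z != y i.+1.
    by apply: contraNneq (yout i (ltn_ord i)) => <-; apply: codom_f.
  rewrite adjE ine /= (negbTE (_ : par (f z) != y i.+1)); last first.
    by apply: contraNneq (yout i (ltn_ord i)) => <-.
  have [-> _] := ypar i (ltn_ord i); rewrite -[i == _]/(i == 0 :> nat) /=.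
  case: (i : nat) (ltn_ord i) => [|k] lek; first by rewrite andbT (inj_eq fI) eq_sym.
  rewrite andbF; apply/negP => /eqP e.
  by have := yout k (ltnW lek); rewrite e codom_f.
pose g (u : attach_stpath x q) := match u with inl v => f v | inr i => tnth t i end.
exists g; split.
- case=> [u|i] [v|j] /=; rewrite ?tE => e.
  + by rewrite (fI _ _ e).
  + by have := yout j (ltn_ord j); rewrite -e codom_f.
  + by have := yout i (ltn_ord i); rewrite e codom_f.
  + by congr inr; apply: val_inj; apply: succn_inj; apply: yI e; apply: ltn_ord.
- case=> [u|i] [v|j] /=; rewrite ?tE.
  + exact: fadj.
  + exact: fy.
  + by rewrite adj_sym fy.
  + have yE (k l : 'I_n.+1) : (par (y k.+1) == y l.+1) = (l.+1 == k).
      have [-> _] := ypar k (ltn_ord k); apply/eqP/eqP => [e|->] //.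
      by rewrite (yI _ _ _ _ e) // ltnW // ltnS.
    rewrite adjE !yE /path_adj orbC andb_idl // => h.
    apply/eqP => /yI; rewrite !ltnS => /(_ (ltn_ord i) (ltn_ord j)) [ij].
    by move: h; rewrite ij -[X in _ == X]addn0 -addn1 eqn_add2l.
- by case=> [u|i] /=; [exact: fs|exact: ts].
- split; first by case/codomP: fr => z ->; apply/codomP; exists (inl z).
  have inc z : z \in codom f -> z \in codom g.
    by case/codomP=> w ->; apply/codomP; exists (inl w).
  case=> [u|[i lti]] /=; first exact: inc.
  rewrite tE /=; have [-> _] := ypar i lti.
  case: i lti => [|i] lti; first exact/inc/codom_f.
  by apply/codomP; exists (inr (Ordinal (ltnW lti))); rewrite /= tE.
Qed.

Lemma P5_embeds : s r = StA -> exists f : start_P5 -> T, embeds f.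
Proof.
move=> sr; have adjE : forall u v, adj u v = (u != v) && ((par u == v) || (par v == u)) by case: hr.
have [pr _ _] := hr.
have child_nbr u v : adj u v -> v != par u -> par v = u.
  by move=> uv ne; case: (rooted_adj hr uv) => -[e _] //; rewrite e eqxx in ne.
have down b : adj r b -> [/\ s b = StB, par b = r & exists c, s c = StC /\ par c = b].
  move=> rb; have sb := nbrA hs sr rb.
  have pb : par b = r by apply: child_nbr; rewrite // pr eq_sym adj_neq.
  split=> //; have [c bc sc] := nbrBC hs sb.
  by exists c; split=> //; apply: child_nbr => //; rewrite pb; apply/eqP => cr; rewrite cr sr in sc.
have [b1 rb1 _] := nbrA2 hs r sr; have [b2 rb2 b21] := nbrA2 hs b1 sr.
have [sb1 pb1 [c1 [sc1 pc1]]] := down _ rb1.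
have [sb2 pb2 [c2 [sc2 pc2]]] := down _ rb2.
pose y := nth r [:: c1; b1; r; b2; c2].
pose f (i : start_P5) := y i.
have st_f (i : start_P5) : s (f i) = st i.
  by rewrite /= (tnth_nth StA) /f; case: i => [[|[|[|[|[|//]]]]] ?].
have fI : injective f.
  have yu : uniq [:: c1; b1; r; b2; c2].
    have sne u v : s u <> s v -> u != v by move=> h; apply/eqP => e; apply: h; rewrite e.
    have c12 : c1 != c2 by apply: contraNneq b21 => e; rewrite -pc2 -e pc1.
    by rewrite /= !inE !negb_or c12 (eq_sym b1 b2) b21 !sne // ?(sb1, sb2, sc1, sc2, sr).
  have yI k l : k < 5 -> l < 5 -> y k = y l -> k = l.
    by move=> ltk ltl /eqP; rewrite /y nth_uniq // => /eqP.
  by move=> i j /(yI _ _ (ltn_ord i) (ltn_ord j))/val_inj.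
(* The parent map read on positions, with the root at position 2. *)
pose p (i : 'I_5) : 'I_5 := inord (nth 0 [:: 1; 2; 2; 2; 3] i).
have fp i : par (f i) = f (p i).
  by rewrite /f /p inordK; case: i => [[|[|[|[|[|//]]]]] ?].
exists f; split=> //.
- move=> i j; rewrite adjE !fp !(inj_eq fI) -!val_eqE /= /path_adj.
  by rewrite !inordK; case: i => [[|[|[|[|[|//]]]]] ?]; case: j => [[|[|[|[|[|//]]]]] ?].
- split; first by apply/codomP; exists (inord 2); rewrite /f inordK.
  by move=> i; rewrite fp codom_f.
Qed.

Lemma embeds_grow (G : stgraph) (f : G -> T) v :
    constructible G -> embeds f -> v \notin codom f ->
  exists (G' : stgraph) (g : G' -> T), [/\ constructible G', embeds g & #|G| < #|G'|].
Proof.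
move=> cG emb vout; case: (@arg_minnP _ v [pred v | v \notin codom f] d vout) => {vout}v /= vout vmin.
have [pr dlt adjE] := hr; have [fI fadj fs [fr fpar]] := emb.
have vr : v != r by apply: contraNneq vout => ->.
have /codomP[x vx] : par v \in codom f.
  by apply: contraLR (dlt _ vr); rewrite -leqNgt; apply: vmin.
have xv : adj (f x) v.
  rewrite adjE vx eqxx orbT andbT; apply: contraNneq vout => <-.
  exact: codom_f.
have child_nbr u w : adj u w -> w != par u -> par w = u.
  by move=> uw ne; case: (rooted_adj hr uw) => -[e _] //; rewrite e eqxx in ne.
have grow n (t : n.+1.-tuple T) (q : n.+1.-tuple status) :
    constructible (attach_stpath x q) ->
    path [rel p v | adj p v && (par v == p)] (f x) t ->
    thead t = v -> (forall i, s (tnth t i) = tnth q i) ->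
  exists (G' : stgraph) (g : G' -> T), [/\ constructible G', embeds g & #|G| < #|G'|].
  move=> cq pt ht ts; have [|g gE] := embeds_attach emb pt _ ts; first by rewrite ht.
  exists (attach_stpath x q), g; split=> //.
  by rewrite card_sum card_ord -addSnnS leq_addr.
have sne u w : s u <> s w -> u != w by move=> h; apply/eqP => e; apply: h; rewrite e.
case sx : (st x); have sfx := fs x; rewrite sx in sfx.
- have sv := nbrA hs sfx xv; have [c vc sc] := nbrBC hs sv.
  have pc : par c = v by apply: child_nbr => //; rewrite vx sne // sc sfx.
  apply: (grow _ [tuple v; c] [tuple StB; StC]) => //.
  + exact: constructible_op2.
  + by rewrite /= xv vx vc pc !eqxx.
  + by case=> [[|[|//]] ?].
(* [G] is itself labelled, so the unique A-neighbour of [f x] is already in the image and the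
   missing [v] must be a C-vertex. *)
- have [a [va' sa' _]] := nbrB (constructible_labelled cG).2 sx.
  have sfa : s (f a) = StA by rewrite fs.
  have fxa : adj (f x) (f a) by rewrite fadj.
  have [va|sv] := nbrBA hs sfx fxa sfa xv; first by rewrite va codom_f in vout.
  apply: (grow _ [tuple v] [tuple StC]) => //.
  + exact: constructible_op1.
  + by rewrite /= xv vx !eqxx.
  + by case=> [[|//] ?].
(* The parent of [v] is a C-vertex, so the A-neighbour of [v] is a child; the labelling supplies the
   rest of the path below it. *)
- have sv := nbrC hs sfx xv; have [a [va sa _]] := nbrB hs sv.
  have pa : par a = v by apply: child_nbr => //; rewrite vx sne // sa sfx.
  have [w aw wv] := nbrA2 hs v sa; have sw := nbrA hs sa aw.
  have pw : par w = a by apply: child_nbr => //; rewrite pa.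
  have [z wz sz] := nbrBC hs sw.
  have pz : par z = w by apply: child_nbr => //; rewrite pw sne // sz sa.
  apply: (grow _ [tuple v; a; w; z] [tuple StB; StA; StB; StC]) => //.
  + exact: constructible_op3.
  + by rewrite /= xv va aw wz vx pa pw pz !eqxx.
  + by case=> [[|[|[|[|//]]]] ?].
Qed.

Lemma embeds_in_family (G : stgraph) (f : G -> T) :
  constructible G -> embeds f -> in_family T.
Proof.
have [k] := ubnP (#|T| - #|G|); elim: k G f => // k IH G f kG cG emb.
have [v vout|onto] := pickP [pred v | v \notin codom f].
  have [G' [g [cG' gE lt]]] := embeds_grow cG emb vout.
  apply: (IH _ _ _ cG' gE); rewrite ltnS in kG; apply: leq_trans kG.
  have leG' : #|G'| <= #|T| by case: gE => gI *; apply: (leq_card g gI).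
  exact: (ltn_sub2l (leq_trans lt leG') lt).
have [fI fadj _ _] := emb; exists G => //.
have [|g fK gK] := @inj_card_bij _ _ f fI.
  rewrite -(card_codom fI); apply: subset_leq_card; apply/subsetP => v _.
  by have := onto v => /= /negbFE.
exists g; first by exists f.
by move=> u v; rewrite -fadj !gK.
Qed.
End Embed.

Lemma labelled_in_family (T : sgraph) (hT : is_tree T) (s : T -> status) :
  labelled s -> in_family T.
Proof.
case=> -[r sr] hs; have [par [d hr]] := tree_rooted hT r.
have [f emb] := P5_embeds hs hr sr.
exact: embeds_in_family hs hr _ _ constructible_start emb.
Qed.

(** * Labelled trees are critical *)

Section LowerBound.
Variables (T : sgraph) (s : T -> status) (r : T) (par : T -> T) (d : T -> nat).
Hypotheses (hs : forall v, ok_at s v) (hr : rooted r par d) (sr : s r = StA).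
Variables (x y b1 y1 : T).
Hypotheses (sb1 : s b1 = StB) (rb1 : adj r b1) (bxy : adj b1 y1).
Hypothesis (xyE : [set x; y] = [set b1; y1]).
Hypothesis (y1P : y1 = r \/ s y1 = StC).

Let Te := subdivide x y.

Definition isA v := if s v is StA then true else false.

Lemma isAP v : reflect (s v = StA) (isA v).
Proof. by rewrite /isA; case: (s v); constructor. Qed.

(** Meaningful for a B-vertex, whose A-neighbour is unique. *)
Definition hub b := odflt b [pick a | adj b a && isA a].

(** A C-vertex may have several B-neighbours; going through its parent assigns it to one unit. *)
Definition unit_of (w : Te) : T :=
  if w is Some v then match s v with StA => v | StB => hub v | StC => hub (par v) end
  else r.

Lemma status_neq u v : s u <> s v -> u <> v.
Proof. by move=> h e; apply: h; rewrite e. Qed.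

Lemma hubE b a : s b = StB -> adj b a -> s a = StA -> hub b = a.
Proof.
move=> sb ba sa; rewrite /hub; case: pickP => [a' /andP[ba' /isAP sa']|/(_ a)].
  by case: (nbrBA hs sb ba sa ba') => //; rewrite sa'.
by rewrite ba /= /isA sa.
Qed.

Lemma child_nbr u v : adj u v -> v <> par u -> par v = u.
Proof. by move=> uv ne; case: (rooted_adj hr uv) => -[e _] //; rewrite e in ne. Qed.

Lemma child_lt u v : adj u v -> par v = u -> d u < d v.
Proof. by move=> uv; apply: (rooted_lt hr (adj_neq uv)). Qed.

Lemma par_root : par r = r. Proof. by case: hr. Qed.

Lemma par_b1 : par b1 = r.
Proof.
apply: child_nbr => //; rewrite par_root => e.
by move: rb1; rewrite e adj_irr.
Qed.

Lemma par_y1 : s y1 = StC -> par y1 = b1.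
Proof.
by move=> sy; apply: child_nbr => //; rewrite par_b1; apply: status_neq; rewrite sy sr.
Qed.

Lemma inE_xy v : v \in [set x; y] = (v == b1) || (v == y1).
Proof. by rewrite xyE !inE. Qed.

Lemma Te_some (u v : T) : v <> b1 -> v <> y1 ->
  @adj Te (Some u) (Some v) = adj u v.
Proof.
move=> vb vy /=; rewrite andb_idr // => _; apply/eqP => e.
by have := set22 u v; rewrite e inE_xy => /orP[]/eqP.
Qed.

Lemma Te_none (v : T) : v <> b1 -> v <> y1 -> @adj Te None (Some v) = false.
Proof. by move=> vb vy; rewrite /= inE_xy; apply/negP => /orP[]/eqP. Qed.

Lemma Te_adj (u v : T) : @adj Te (Some u) (Some v) -> adj u v.
Proof. by case/andP. Qed.

(* The root unit may reach [a] through the new vertex, which is why [None] is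
   assigned to it. *)
Lemma unit_nbrA a (w : Te) :
  s a = StA -> w = Some a \/ adj w (Some a) -> unit_of w = a.
Proof.
move=> sa [->|]; first by rewrite /= sa.
case: w => [b /Te_adj ba|].
  rewrite adj_sym in ba; have sb := nbrA hs sa ba.
  by rewrite /= sb; apply: hubE; rewrite // adj_sym.
rewrite /= inE_xy => /orP[]/eqP e; first by rewrite e sb1 in sa.
by case: y1P => [<-|sy]; [|rewrite e sy in sa].
Qed.

(** For a B-child [b] of [a], this is the closed neighbourhood of [b] in [T]. *)
Definition near a b v : Prop := [\/ v = a, v = b | s v = StC /\ par v = b].

(* For [crossing v] the path from the root enters the unit of [v] through [v]. *)
Definition crossing v : Prop := s v = StB /\ s (par v) = StC.

(** * Child edges of A-vertices away from the subdivided edge *)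

Section Child.
Variables (a b : T).
Hypotheses (sa : s a = StA) (ab : adj a b) (pb : par b = a) (bb1 : b <> b1).

Let sb : s b = StB. Proof. exact: (nbrA hs sa ab). Qed.

Let by1 : b <> y1.
Proof. by case: y1P => [->|sy]; apply: status_neq; rewrite sb ?sr ?sy. Qed.

Lemma near_unit v : near a b v -> unit_of (Some v) = a.
Proof.
have hb : hub b = a by apply: hubE; rewrite // adj_sym.
by case=> [->|->|[sv pv]] /=; rewrite ?sa ?sb // sv pv.
Qed.

Lemma near_nbrB (w : Te) : w = Some b \/ adj w (Some b) ->
  exists2 v, w = Some v & near a b v.
Proof.
case=> [->|]; first by exists b => //; apply: Or32.
case: w => [v /Te_adj vb|]; last by rewrite Te_none.
exists v => //; rewrite adj_sym in vb.
have ba : adj b a by rewrite adj_sym.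
have [->|sv] := nbrBA hs sb ba sa vb; first exact: Or31.
by apply: Or33; split=> //; apply: child_nbr => //; rewrite pb; apply: status_neq; rewrite sv sa.
Qed.

Lemma Te_child : @adj Te (Some a) (Some b).
Proof. by rewrite (Te_some _ bb1 by1). Qed.

(** The edge from [b] to a C-child [c] must be covered. Dominators of [b] are near; those of [c] are
    [c], [b] and the B-children of [c], which are crossing and deeper. *)
Lemma near_dominator (D : {set Te}) : isolating D ->
  exists2 v, Some v \in D & near a b v \/ crossing v /\ d b < d v.
Proof.
move=> /isolatingP iD; have [c bc sc] := nbrBC hs sb.
have pc : par c = b by apply: child_nbr => //; rewrite pb; apply: status_neq; rewrite sc sa.
have cb1 : c <> b1 by apply: status_neq; rewrite sc sb1.
have cy1 : c <> y1.
  by move=> e; rewrite e in pc sc; rewrite par_y1 // in pc; apply: bb1.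
have : @adj Te (Some b) (Some c) by rewrite Te_some.
case/iD=> /closed_nbhdP[w wD].
  by case/near_nbrB=> v wv nv; exists v; rewrite -?wv //; left.
case=> [wc|]; first by exists c; rewrite -?wc //; left; apply: Or33.
case: w wD => [v vD /Te_adj vc|_]; last by rewrite Te_none.
exists v => //; rewrite adj_sym in vc; have sv := nbrC hs sc vc.
case: (rooted_adj hr vc) => -[pv dcv]; first by left; apply: Or32; rewrite -pc pv.
by right; split; [split; rewrite ?pv|apply: ltn_trans dcv; apply: child_lt].
Qed.

End Child.

(** All neighbours of the root are children, so there any [b0] can be avoided; elsewhere avoiding
    the parent gives a child. *)
Lemma exists_child a (sa : s a = StA) (b0 : T) : (a = r \/ b0 = par a) ->
  exists b, [/\ adj a b, par b = a & b <> b0].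
Proof.
move=> h; have [b ab /eqP bb0] := nbrA2 hs b0 sa; exists b; split=> //.
apply: child_nbr => //; case: h => [ar|<- //].
by rewrite ar par_root; apply: status_neq; rewrite sr (nbrA hs sa ab).
Qed.

Lemma exists_child_off a (sa : s a = StA) :
  exists b, [/\ adj a b, par b = a & b <> b1].
Proof.
have [ar|ar] := eqVneq a r; first by apply: exists_child => //; left.
have [b [ab pb _]] := exists_child sa (or_intror (erefl (par a))).
by exists b; split=> // e; move: ar; rewrite -pb e par_b1 eqxx.
Qed.

(** For a child [b] of [a] other than [b1], the edge [ab] survives the subdivision and the closed
    neighbourhoods of both ends lie in the unit of [a]. *)
Lemma unit_hit (D : {set Te}) a : isolating D -> s a = StA ->
  exists2 w, w \in D & unit_of w = a.
Proof.
move=> /isolatingP iD sa; have [b [ab pb bb1]] := exists_child_off sa.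
case: (iD _ _ (Te_child sa ab bb1)) => /closed_nbhdP[w wD h]; exists w => //.
  exact: unit_nbrA.
by have [v -> nv] := near_nbrB sa ab pb bb1 h; apply: near_unit nv.
Qed.

(** * Isolating sets with no more elements than there are A-vertices *)

Section Small.
Variable D : {set Te}.
Hypotheses (iD : isolating D) (cD : #|D| <= #|[set a | isA a]|).

Lemma unit_inj : {in D &, injective unit_of}.
Proof.
apply/imset_injP; rewrite eqn_leq leq_imset_card /=.
apply: leq_trans cD (subset_leq_card _); apply/subsetP => a.
rewrite inE => /isAP sa; have [w wD <-] := unit_hit iD sa.
exact: imset_f.
Qed.

(* A member [b] of [D] lying above its hub [a] uses up the unit of [a], so the
   edges below the other neighbours of [a] need such a member deeper down. *)
Lemma no_crossing v : Some v \in D -> ~ crossing v.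
Proof.
(* Induction on [m - d v] treats the deepest vertices first. *)
pose m := \max_u d u.
have dm u : d u <= m by apply: leq_bigmax.
have [n] := ubnP (m - d v); elim: n v => // n IH b mn bD [sb spb].
have [a [ba sa _]] := nbrB hs sb.
have pa : par a = b by apply: child_nbr => //; apply: status_neq; rewrite spb sa.
have [b' [ab' pb' bb']] := exists_child sa (or_intror (esym pa)).
have b'b1 : b' <> b1.
  by move=> e; move: pb'; rewrite e par_b1 => ar; move: spb; rewrite -pa -ar !par_root sr.
have ub : unit_of (Some b) = a by rewrite /= sb; apply: hubE.
have [v vD [nv|cv]] := near_dominator sa ab' pb' b'b1 iD.
  have [e] : Some v = Some b by apply: unit_inj => //; rewrite ub (near_unit sa ab').
  move: nv; rewrite e => -[e1|e1|[sc _]].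
  - by rewrite e1 sa in sb.
  - exact: bb'.
  - by rewrite sc in sb.
have [{}cv dv] := cv; apply: (IH v) vD cv.
have dbv : d b < d v.
  by apply: ltn_trans dv; apply: ltn_trans (child_lt ab' pb'); apply: child_lt.
rewrite ltnS in mn; apply: leq_trans mn.
exact: (ltn_sub2l (leq_trans dbv (dm v)) dbv).
Qed.

Lemma near_hit a b : s a = StA -> adj a b -> par b = a -> b <> b1 ->
  exists2 v, Some v \in D & near a b v.
Proof.
move=> sa ab pb bb1; have [v vD [nv|[cv _]]] := near_dominator sa ab pb bb1 iD.
  by exists v.
by case: (no_crossing vD cv).
Qed.

Lemma edge_hit : exists2 w : Te, w \in D &
  w = None \/ exists2 v, w = Some v & v = b1 \/ s v = StC /\ par v = b1.
Proof.
have b1r : adj b1 r by rewrite adj_sym.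
have nbr_b1 v : adj b1 v -> v <> r -> s v = StC /\ par v = b1.
  move=> bv vr; split; last by apply: child_nbr; rewrite // par_b1.
  by case: (nbrBA hs sb1 b1r sr bv).
have nbr_C c v : s c = StC -> par c = b1 -> adj c v -> Some v \in D -> v = b1.
  move=> sc pc cv vD; case: (rooted_adj hr cv) => -[pv _]; first by rewrite -pc pv.
  by case: (no_crossing vD); split; rewrite ?pv // (nbrC hs sc cv).
(* If [b1 r] is subdivided, [r] no longer dominates [b1], and covering an edge from [b1] to a
   C-child gives the claim. Otherwise the edge from the new vertex to [y1] does. *)
case: y1P => [yr|sy].
  have [c bc sc] := nbrBC hs sb1.
  have pc : par c = b1.
    by apply: child_nbr => //; rewrite par_b1; apply: status_neq; rewrite sc sr.
  have cb1 : c <> b1 by apply: status_neq; rewrite sc sb1.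
  have cy1 : c <> y1 by apply: status_neq; rewrite sc yr sr.
  have : @adj Te (Some b1) (Some c) by rewrite Te_some.
  have /isolatingP := iD; move=> /[apply] -[] /closed_nbhdP[w wD h]; exists w => //.
    case: h => [->|]; first by right; exists b1; auto.
    case: w wD => [v vD vb|_ _]; last by left.
    right; exists v => //; right; apply: nbr_b1; first by rewrite adj_sym (Te_adj vb).
    move=> vr; move: vb; rewrite vr /= -yr xyE setUC eqxx andbF //.
  case: h => [->|]; first by right; exists c; auto.
  case: w wD => [v vD /Te_adj vc|_]; last by rewrite Te_none.
  by right; exists v => //; left; apply: nbr_C sc pc _ vD; rewrite adj_sym.
have : @adj Te None (Some y1) by rewrite /= inE_xy eqxx orbT.
have /isolatingP := iD; move=> /[apply] -[] /closed_nbhdP[w wD h]; exists w => //.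
  case: h => [->|]; first by left.
  case: w wD => [v vD|_] //=; rewrite inE_xy => /orP[]/eqP->; right.
    by exists b1; auto.
  by exists y1 => //; right; rewrite par_y1.
case: h => [->|]; first by right; exists y1 => //; right; rewrite par_y1.
case: w wD => [v vD /Te_adj vc|_ _]; last by left.
right; exists v => //; left; apply: nbr_C sy (par_y1 sy) _ vD.
by rewrite adj_sym.
Qed.

(** The root has a child [b] other than [b1]. The elements of [D] found by [near_hit] at [b] and by
    [edge_hit] at [b1] are distinct but share the unit of [r]. *)
Lemma small_isolating_absurd : False.
Proof.
have [b [rb pb bb1]] := exists_child sr (or_introl (erefl r) : r = r \/ b1 = par r).
have [v vD nv] := near_hit sr rb pb bb1; have [w wD hw] := edge_hit.
have uv := near_unit sr rb nv.
have uw : unit_of w = r.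
  have hb1 : hub b1 = r by apply: hubE; rewrite // adj_sym.
  by case: hw => [->|[v' -> [->|[sv' pv']]]] //=; rewrite ?sb1 ?sv' ?pv'.
have e : w = Some v by apply: unit_inj; rewrite // uw uv.
have sb : s b = StB by apply: (nbrA hs sr rb).
case: hw => [|[v']]; rewrite e // => -[<-] [vE|[sv pv]].
  case: nv => [vr|vb|[sv _]].
  - by have := sb1; rewrite -vE vr sr.
  - by rewrite -vE vb in bb1.
  - by have := sb1; rewrite -vE sv.
case: nv => [vr|vb|[_ pv']].
- by rewrite vr sr in sv.
- by rewrite vb sb in sv.
- by rewrite -pv' pv in bb1.
Qed.

End Small.
End LowerBound.

(** Every edge has a B-end, and every B-vertex has an A-neighbour. *)
Lemma labelled_isolating (T : sgraph) (s : T -> status) :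
  (forall v, ok_at s v) -> isolating [set a | isA s a].
Proof.
move=> hs; apply/isolatingP.
have dB b : s b = StB -> b \in closed_nbhd [set a | isA s a].
  move=> sb; have [a [ba sa _]] := nbrB hs sb; apply/closed_nbhdP.
  by exists a; [rewrite inE; apply/isAP|right; rewrite adj_sym].
move=> u v uv; case su: (s u).
- by right; apply: dB; apply: (nbrA hs su).
- by left; apply: dB.
- by right; apply: dB; apply: (nbrC hs su).
Qed.

Lemma labelled_critical (T : sgraph) (hT : is_tree T) (s : T -> status) :
  labelled s -> iota1_critical T.
Proof.
case=> -[a sa] hs; split; first by have [b ab _] := nbrA2 hs a sa; exists a, b.
move=> x y xy.
(* Rooting at the A-neighbour of the B-end [b1] forces the other end [y1] to be the root or a
   C-vertex. *)
have [b1 [y1 [sb1 b1y1 xyE]]] : exists b1 y1,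
    [/\ s b1 = StB, adj b1 y1 & [set x; y] = [set b1; y1]].
  case sx: (s x); last 2 first.
  - by exists x, y.
  - by exists y, x; rewrite adj_sym setUC; split=> //; apply: (nbrC hs sx).
  - by exists y, x; rewrite adj_sym setUC; split=> //; apply: (nbrA hs sx).
have [r [b1r sr hb1]] := nbrB hs sb1.
have rb1 : adj r b1 by rewrite adj_sym.
have [par [d hr]] := tree_rooted hT r.
have [D iD <-] := isolation_number_ex (subdivide x y).
apply: leq_ltn_trans (isolation_number_le (labelled_isolating hs)) _.
rewrite ltnNge; apply/negP => cD.
exact: (small_isolating_absurd hs hr sr sb1 rb1 b1y1 xyE (hb1 _ b1y1) iD cD).
Qed.

(** * Isomorphism invariance and the equivalence *)

Lemma isomorphic_labelled (T G : sgraph) (s : G -> status) :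
  isomorphic T G -> labelled s -> exists s' : T -> status, labelled s'.
Proof.
case=> f [g fK gK] fadj [[a sa] hs]; exists (s \o f).
have gadj u v : adj u (g v) = adj (f u) v by rewrite -fadj gK.
split; first by exists (g a); rewrite /= gK.
move=> v; have := hs (f v); rewrite /ok_at /=; case: (s (f v)).
- case=> hB h2; split=> [y|w]; first by rewrite -fadj; apply: hB.
  have [b vb bw] := h2 (f w); exists (g b); first by rewrite gadj.
  by apply: contraNneq bw => <-; rewrite gK.
- case=> -[a' [va sa' h]] [c vc sc]; split; last by exists (g c); rewrite ?gadj ?gK.
  exists (g a'); rewrite gadj gK; split=> // y; rewrite -fadj => /h[<-|]; last by right.
  by left; rewrite fK.
- by move=> h y; rewrite -fadj; apply: h.
Qed.

Unset Implicit Arguments.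

Theorem theorem4p11 (T : sgraph) (hT : is_tree T) :
  iota1_critical T <-> in_family T.
Proof.
split=> [crit|[G cG iso]].
  by have [s hs] := critical_labelled crit hT; apply: labelled_in_family hT _ hs.
have [s hs] := isomorphic_labelled iso (constructible_labelled cG).
exact: labelled_critical hT _ hs.
Qed.
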